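(* When $\tau=m/2$, every instance admits an agent whose demand vector satisfies at least $\frac{n+1}{2}$ agents, and this lower bound is tight.
   Context: An instance with a set of agents $[n]=\{1,\dots,n\}$ and $m$ projects consists of demands $d^i_j\in[0,1]$ for $i\in[n]$ and $j\in[m]=\{1,\dots,m\}$, with $\sum_{j=1}^m d^i_j\le 1$ for every agent $i$. The demand vector of agent $i$ is $(d^i_1,\dots,d^i_m)$. A solution is a vector $\mathbf{x}\in[0,1]^m$; in particular, the demand vector of an agent can be used as a solution. Agent $i$ is locally satisfied by $\mathbf{x}$ for project $j$ if $x_j\ge d^i_j$. Given a threshold $\tau\in[1,m]$ (not necessarily an integer), agent $i$ is satisfied by $\mathbf{x}$ if she is locally satisfied by $\mathbf{x}$ for at least $\tau$ projects. *)

(* Defs.v *)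
From HB Require Import structures.
From mathcomp Require Import all_boot all_order all_algebra.
From mathcomp Require Import reals.

Set Implicit Arguments.
Unset Strict Implicit.
Unset Printing Implicit Defensive.

Import Order.TTheory GRing.Theory Num.Theory.
Local Open Scope ring_scope.

Record instance (R : realType) (n m : nat) := Instance {
  demand : 'I_n -> 'rV[R]_m;
  demand_itv : forall i j, 0 <= demand i 0 j <= 1;
  demand_sum : forall i, \sum_j demand i 0 j <= 1
}.

Definition locally_satisfied (R : realType) (n m : nat) (I : instance R n m)
    (x : 'rV[R]_m) (i : 'I_n) (j : 'I_m) : bool :=
  demand I i 0 j <= x 0 j.

(* The threshold is a real number, hence the cast of the cardinal. *)
Definition satisfied (R : realType) (n m : nat) (I : instance R n m)
    (tau : R) (x : 'rV[R]_m) (i : 'I_n) : bool :=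
  tau <= #|[set j | locally_satisfied I x i j]|%:R.

Definition num_satisfied (R : realType) (n m : nat) (I : instance R n m)
    (tau : R) (x : 'rV[R]_m) : nat :=
  #|[set i | satisfied I tau x i]|.

(* Main.v *)
(** Of two agents, each at least matches the other on one of two sets of
    projects covering all of them, so one of the two vectors satisfies the other
    agent. Hence at least n(n+1)/2 ordered pairs (i, k) have k satisfied by the
    vector of i, and some i reaches the average (n+1)/2.

    For tightness take n agents, n projects and demands proportional to
    (i + j) mod n. The vector of i satisfies k exactly when (i - k) mod n is at
    most n/2, which holds for floor(n/2) + 1 agents k. *)
Require Import Defs.
From HB Require Import structures.
From mathcomp Require Import all_boot all_order all_algebra.
From mathcomp Require Import reals.
From mathcomp Require Import zify.

Set Implicit Arguments.
Unset Strict Implicit.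
Unset Printing Implicit Defensive.

Import Order.TTheory GRing.Theory Num.Theory.
Local Open Scope ring_scope.

Lemma half_leE (R : realType) (m c : nat) :
  (m%:R / 2 <= c%:R :> R) = (m <= c.*2)%N.
Proof. by rewrite ler_pdivrMr ?ltr0n // -natrM ler_nat muln2. Qed.

Lemma satisfied_halfE (R : realType) (n m : nat) (I : instance R n m) x i :
  satisfied I (m%:R / 2) x i
    = (m <= #|[set j | locally_satisfied I x i j]|.*2)%N.
Proof. exact: half_leE. Qed.

Lemma satisfied_self (R : realType) (n m : nat) (I : instance R n m) i :
  satisfied I (m%:R / 2) (demand I i) i.
Proof.
rewrite satisfied_halfE (_ : [set j | _] = setT) ?cardsT ?card_ord; first by lia.
by apply/setP => j; rewrite !inE /locally_satisfied lexx.
Qed.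

Lemma satisfied_total (R : realType) (n m : nat) (I : instance R n m) i k :
  satisfied I (m%:R / 2) (demand I i) k || satisfied I (m%:R / 2) (demand I k) i.
Proof.
rewrite !satisfied_halfE.
set A := [set j | _]; set B := [set j | _].
have : (#|A :|: B| <= #|A| + #|B|)%N by rewrite cardsU leq_subr.
have -> : A :|: B = setT.
  by apply/setP => j; rewrite !inE /locally_satisfied le_total.
rewrite cardsT card_ord; lia.
Qed.

(** Each ordered pair contributes [r i k + r k i], which is at least 1 by totality and equals 2 on
    the diagonal by reflexivity. *)
Lemma sum_total_rel (T : finType) (r : rel T) :
  reflexive r -> total r ->
  (#|T| * #|T|.+1 <= (\sum_i \sum_k r i k).*2)%N.
Proof.
move=> rr rt.
have diag : (\sum_i \sum_(k : T) (i == k) = #|T|)%N.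
  rewrite -sum1_card; apply: eq_bigr => i _.
  by rewrite (bigD1 i) //= eqxx big1 // => k; rewrite eq_sym => /negPf ->.
have sq : (\sum_(i : T) \sum_(k : T) 1 = #|T| * #|T|)%N.
  by rewrite !sum_nat_const muln1.
(* Transposing one of the two copies of the sum leaves the termwise bound
   [(i == k) + 1 <= r i k + r k i]. *)
rewrite -addnn {2}exchange_big /= mulnS -sq -{1}diag -!big_split /=.
apply: leq_sum => i _; rewrite -!big_split /=; apply: leq_sum => k _.
by have [->|_] := eqVneq i k; [rewrite rr | have := rt i k; case: (r i k); case: (r k i)].
Qed.

Lemma num_satisfied_sum (R : realType) (n m : nat) (I : instance R n m) tau x :
  num_satisfied I tau x = (\sum_k satisfied I tau x k)%N.
Proof.
rewrite /num_satisfied -sum1_card big_mkcond /=.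
by apply: eq_bigr => k _; rewrite inE; case: satisfied.
Qed.

Lemma exists_half_satisfied (R : realType) (n m : nat) (I : instance R n m) :
  (0 < n)%N ->
  exists i, (n < (num_satisfied I (m%:R / 2) (demand I i)).*2)%N.
Proof.
move=> n0; apply/existsP; apply: contraT; rewrite negb_exists => /forallP small.
have := @sum_total_rel _ (fun i k => satisfied I (m%:R / 2) (demand I i) k)
  (satisfied_self I) (satisfied_total I).
under eq_bigr do rewrite -num_satisfied_sum.
rewrite card_ord -muln2 big_distrl /=.
(* If no agent works, twice the number of pairs is at most n * n, less than n * (n + 1). *)
have : (\sum_(i < n) num_satisfied I (m%:R / 2) (demand I i) * 2 <= \sum_(i < n) n)%N.
  by apply: leq_sum => i _; have := small i; rewrite -leqNgt muln2.
rewrite sum_nat_const card_ord => ub /leq_trans /(_ ub).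
by rewrite leq_pmul2l ?ltnn.
Qed.

Lemma card_ord_lt (q b : nat) : (#|[set s : 'I_q | (s < b)%N]| <= b)%N.
Proof.
rewrite cardE -(size_map val) -[leqRHS](size_iota 0).
apply: uniq_leq_size; first by rewrite map_inj_uniq ?enum_uniq //; exact: val_inj.
by move=> x /mapP[s]; rewrite mem_enum inE mem_iota => ? ->.
Qed.

(** When [s + y] wraps around, it becomes [s + y - p.+1], which is below [y]; so only the [y] below
    [p.+1 - s] can count. *)
Lemma card_nondecreasing_rotation (p : nat) (s : 'I_p.+1) :
  s != 0 -> (#|[set y : 'I_p.+1 | (y <= (s + y)%R)%N]| <= p.+1 - s)%N.
Proof.
move=> s0; have {}s0 : (0 < s)%N by rewrite lt0n.
apply: leq_trans (card_ord_lt p.+1 (p.+1 - s)).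
apply/subset_leq_card/subsetP => y; rewrite !inE /=.
have [//|wrap] := ltnP y (p.+1 - s).
have sy : (p.+1 <= s + y)%N by lia.
rewrite -(subnK sy) modnDr modn_small; have := ltn_ord s; have := ltn_ord y; lia.
Qed.

Section Cyclic.
Variables (R : realType) (p : nat).

(** The sum [i + j] is modulo [p.+1]. The square in the divisor keeps each entry at most 1/(p+1), so
    a row sums to at most 1. *)
Definition cyclic_demand (i : 'I_p.+1) : 'rV[R]_p.+1 :=
  \row_j (((i + j)%R : nat)%:R / (p.+1 ^ 2)%:R).

Lemma cyclic_demand_le i j : 0 <= cyclic_demand i 0 j <= p.+1%:R^-1.
Proof.
rewrite mxE divr_ge0 ?ler0n //= ler_pdivrMr ?ltr0n ?expn_gt0 //.
by rewrite natrX expr2 mulKf ?pnatr_eq0 // ler_nat ltnW // ltn_pmod.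
Qed.

Lemma cyclic_demand_itv i j : 0 <= cyclic_demand i 0 j <= 1.
Proof.
have /andP[-> /= /le_trans->//] := cyclic_demand_le i j.
by rewrite invf_le1 ?ler1n ?ltr0n.
Qed.

Lemma cyclic_demand_sum i : \sum_j cyclic_demand i 0 j <= 1.
Proof.
apply: (@le_trans _ _ (\sum_(j < p.+1) p.+1%:R^-1)).
  by apply: ler_sum => j _; case/andP: (cyclic_demand_le i j).
by rewrite sumr_const card_ord -[_ *+ _]mulr_natl divff ?pnatr_eq0.
Qed.

Definition cyclic_instance : instance R p.+1 p.+1 :=
  Instance cyclic_demand_itv cyclic_demand_sum.

Lemma cyclic_satisfied i k :
  satisfied cyclic_instance (p.+1%:R / 2) (demand cyclic_instance i) k ->
  ((i - k)%R < p.+1./2.+1)%N.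
Proof.
rewrite satisfied_halfE.
(* The substitution [y = k + j] makes the count depend on [i - k] only. *)
have -> : [set j | locally_satisfied cyclic_instance (demand cyclic_instance i) k j]
    = +%R k @^-1: [set y : 'I_p.+1 | (y <= (i - k + y)%R)%N].
  apply/setP => j; rewrite !inE /locally_satisfied !mxE addrA subrK.
  by rewrite ler_pM2r ?invr_gt0 ?ltr0n ?expn_gt0 // ler_nat.
rewrite on_card_preimset; last first.
  by exists (+%R (- k)) => y _; rewrite ?addKr ?addNKr // addrA subrr add0r.
(* For nonzero [s = i - k], at most [p.+1 - s] projects count, and twice this must reach [p.+1]. *)
have [->//|/card_nondecreasing_rotation] := eqVneq (i - k) 0.
have := ltn_ord (i - k); move: #|_| => c; move: (nat_of_ord (i - k)) => s; lia.
Qed.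

Lemma cyclic_num_satisfied i :
  (num_satisfied cyclic_instance (p.+1%:R / 2) (demand cyclic_instance i)
     <= uphalf p.+2)%N.
Proof.
(* [uphalf p.+2] computes to [p.+1./2.+1], and [k] is determined by [i - k]. *)
apply: leq_trans (card_ord_lt p.+1 p.+1./2.+1).
have inj : injective (fun k : 'I_p.+1 => i - k).
  by move=> k l /addrI /oppr_inj.
rewrite /num_satisfied -(card_imset _ inj).
apply/subset_leq_card/subsetP => _ /imsetP[k + ->].
by rewrite !inE; exact: cyclic_satisfied.
Qed.

End Cyclic.

Lemma zero_demand_itv (R : realType) (n m : nat) (i : 'I_n) (j : 'I_m) :
  0 <= (0 : 'rV[R]_m) 0 j <= 1.
Proof. by rewrite mxE lexx ler01. Qed.

Lemma zero_demand_sum (R : realType) (n m : nat) (i : 'I_n) :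
  \sum_j (0 : 'rV[R]_m) 0 j <= 1.
Proof. by rewrite big1 ?ler01 // => j _; rewrite mxE. Qed.

Definition zero_instance (R : realType) (n m : nat) : instance R n m :=
  Instance (@zero_demand_itv R n m) (@zero_demand_sum R n m).

(** The lower bound on the maximum comes from [exists_half_satisfied], rounded up to an integer. *)
Lemma max_num_satisfied (R : realType) (n m : nat) (I : instance R n m) :
  (0 < n)%N ->
  (forall i, num_satisfied I (m%:R / 2) (demand I i) <= uphalf n.+1)%N ->
  (\max_(i < n) num_satisfied I (m%:R / 2) (demand I i))%N = uphalf n.+1.
Proof.
move=> n0 ub; apply/eqP; rewrite eqn_leq; apply/andP; split.
  by apply/bigmax_leqP => i _; exact: ub.
have [i lb] := exists_half_satisfied I n0.
apply: leq_trans (leq_bigmax i); move: lb; lia.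
Qed.

(* MathComp world. The condition tau = m/2 in [1, m] means 1 < m. Tightness:
   for every n, some instance with n agents has ceil((n+1)/2) as the largest
   number of agents satisfied by an agent's demand vector. *)
Theorem theorem1 (R : realType) :
  (forall (n m : nat), (0 < n)%N -> (1 < m)%N ->
     forall I : instance R n m,
       exists i : 'I_n,
         (n%:R + 1) / 2 <=
           (num_satisfied I (m%:R / 2) (demand I i))%:R :> R)
  /\
  (forall n : nat, (0 < n)%N ->
     exists m : nat, (1 < m)%N /\
       exists I : instance R n m,
         (\max_(i < n) num_satisfied I (m%:R / 2) (demand I i))%N
           = uphalf n.+1).
Proof.
split=> [n m n0 _ I | [//|[|p]] _].
- have [i lb] := exists_half_satisfied I n0.
  by exists i; rewrite natr1 half_leE.
(* One agent with one project is excluded by [1 < m]. *)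
- exists 2%N; split=> //; exists (zero_instance R 1 2).
  apply: max_num_satisfied => // i.
  by apply: leq_trans (max_card _) _; rewrite card_ord.
- exists p.+2; split=> //; exists (cyclic_instance R p.+1).
  by apply: max_num_satisfied => // i; exact: cyclic_num_satisfied.
Qed.
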